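(* Suppose that, for the given capacities $\mu_j(\cdot)$, $j=1,\dots,J$, the constrained optimization problem $(P)$ has a solution. Let $x^{\ast}\in\mathbb{R}^2$ be a given solution of the weighted Weber problem $\min_{x\in\mathbb{R}^2}\sum_{j=2}^J\rho_jd_j(x)$. Then the solution of $(P)$ with location $x^{\ast}$ is uniquely determined: there is exactly one $N\in\{1,2,\dots\}$ such that $(N,x^{\ast})$ is a solution of $(P)$.
   Context: Data: an integer $J\ge 2$; warehouses $j=2,\dots,J$ with locations $a_j\in\mathbb{R}^2$ and demands $D_j>0$; $D=\sum_{j=2}^J D_j$, $\rho_j=D_j/D$ (so $\sum_{j=2}^J\rho_j=1$); a convex function $d:\mathbb{R}^2\times\mathbb{R}^2\to[0,\infty)$, and $d_j(x):=d(a_j,x)$; for $j=1,\dots,J$ an integer $s_j\ge 1$ and a real $\mu_j>0$, with $\mu_j(n):=\mu_j\min(n,s_j)$, $n\in\mathbb{N}$. Node $1$ is the production center, located at $x\in\mathbb{R}^2$. Network: for $N\ge1$ and $x\in\mathbb{R}^2$, $N$ trucks circulate in a closed queueing network (Gordon–Newell network) with node set $\bar J=\{1,2,\dots,J,2a,\dots,Ja,2b,\dots,Jb\}$. Node $j\in\{1,\dots,J\}$ is a first-come-first-served exponential station with total service rate $\mu_j(n_j)$ when $n_j$ trucks are present. Nodes $ja$ and $jb$ ($j=2,\dots,J$) are infinite-server stations with exponential service times (travel times) of mean $d_j(x)$, i.e. total rates $\mu_{ja}(x)(n)=\mu_{jb}(x)(n)=n/d_j(x)$. All service times and routing decisions are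 independent. Routing: $r(1,ja)=\rho_j$, $r(ja,j)=r(j,jb)=r(jb,1)=1$ for $j=2,\dots,J$, all other $r(k,m)=0$. Thus the queue length vector is a continuous-time Markov chain on $S(N,\bar J)=\{(n_i)_{i\in\bar J}\in\mathbb{N}^{\bar J}:\sum_i n_i=N\}$ which jumps from $n$ to $n-e_i+e_k$ (for $n_i\ge1$) at rate (total service rate of node $i$ at $n_i$) $\cdot\, r(i,k)$. Let $\pi(\cdot;x)$ be its unique stationary distribution. (If $d_j(x)=0$, travel on $ja,jb$ is instantaneous, and $n_{ja}=n_{jb}=0$ always.) Throughput: for $j=2,\dots,J$, $TH_j(N;x)=\sum_{n\in S(N,\bar J)}\pi(n;x)\mu_j(n_j)$ is the stationary mean number of truck departures per time unit from warehouse $j$, and $TH_w(N;x)=\sum_{j=2}^J TH_j(N;x)$. Demands and throughputs are measured in truck loads per common time unit. Problem $(P)$: determine $\min_{N\ge1}\big(\max_{x\in\mathbb{R}^2}TH_w(N;x)\big)$ and its arguments, subject to $TH_j(N;x)\ge D_j$ for $j=2,\dots,J$. A solution is a pair $(N,x)$ such that $TH_j(N;x)\ge D_j$ for all $j=2,\dots,J$, $TH_w(N;x)=\max_{y\in\mathbb{R}^2}TH_w(N;y)$, and this value is minimal among all $N'\ge 1$ for which there is a maximizer $x'$ of $TH_w(N';\cdot)$ with $TH_j(N';x')\ge D_j$ for all $j=2,\dots,J$. *)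

(* Defs.v *)
From HB Require Import structures.
From mathcomp Require Import all_boot all_order all_algebra.
From mathcomp Require Import all_classical all_reals convex.

Set Implicit Arguments.
Unset Strict Implicit.
Unset Printing Implicit Defensive.

Import Order.TTheory GRing.Theory Num.Theory.

Local Open Scope ring_scope.

(* The warehouses 2, ..., J are indexed by 'I_J.-1: the ordinal i stands for  *)
(* warehouse i + 2. The first-come-first-served stations 1, ..., J are        *)
(* indexed by option 'I_J.-1, where None stands for the production center 1.  *)
Definition station (J : nat) : finType := option 'I_J.-1.

Definition node (J : nat) : finType := (station J + ('I_J.-1 + 'I_J.-1))%type.

Notation center := (inl None).             (* node 1  *)
Notation warehouse j := (inl (Some j)).    (* node j  *)
Notation outbound j := (inr (inl j)).      (* node ja *)
Notation inbound j := (inr (inr j)).       (* node jb *)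

Section Network.

Variables (R : realType) (J : nat).
Variables (a : 'I_J.-1 -> 'rV[R]_2) (D : 'I_J.-1 -> R).
Variable d : 'rV[R]_2 * 'rV[R]_2 -> R.
Variables (s : station J -> nat) (mu : station J -> R).

Definition rho (j : 'I_J.-1) : R := D j / \sum_k D k.

Definition dist (x : 'rV[R]_2) (j : 'I_J.-1) : R := d (a j, x).

Definition station_rate (k : station J) (n : nat) : R :=
  mu k * (minn n (s k))%:R.

(* When dist x j = 0, the nodes ja and jb are never occupied (see states_at), *)
(* so the value of their rate is irrelevant.                                  *)
Definition service_rate (x : 'rV[R]_2) (i : node J) (n : nat) : R :=
  match i with
  | inl k => station_rate k n
  | outbound j | inbound j => n%:R / dist x j
  end.

Definition routing (i k : node J) : R :=
  match i, k with
  | center, outbound j => rho j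
  | outbound j, warehouse l => (j == l)%:R
  | warehouse j, inbound l => (j == l)%:R
  | inbound _, center => 1
  | _, _ => 0
  end.

Definition instantaneous (x : 'rV[R]_2) (i : node J) : bool :=
  match i with
  | inl _ => false
  | outbound j | inbound j => dist x j == 0
  end.

(* Routing probabilities once the instantaneous nodes are passed through in   *)
(* zero time. Passing through one node is enough, since a travel node is      *)
(* always followed by a station, which is not instantaneous. If all distances *)
(* are nonzero, this is routing itself.                                       *)
Definition routing_at (x : 'rV[R]_2) (i k : node J) : R :=
  if instantaneous x k then 0
  else routing i k + \sum_(m | instantaneous x m) routing i m * routing m k.

Definition state (N : nat) : finType := {ffun node J -> 'I_N.+1}.

Definition states (N : nat) : {set state N} :=
  [set n : state N | (\sum_i n i)%N == N].

Definition states_at (N : nat) (x : 'rV[R]_2) : {set state N} :=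
  [set n in states N | [forall i, instantaneous x i ==> (n i == 0 :> nat)]].

(* n' = n - e_i + e_k, with n_i >= 1 *)
Definition jump (N : nat) (n : state N) (i k : node J) (n' : state N) : bool :=
  (0 < n i)%N && [forall m, (n' m + (m == i) == n m + (m == k))%N].

Definition transition_rate (N : nat) (x : 'rV[R]_2) (n n' : state N) : R :=
  \sum_i \sum_(k | jump n i k n') service_rate x i (n i) * routing_at x i k.

Definition is_stationary (N : nat) (x : 'rV[R]_2) (p : {ffun state N -> R}) :
    Prop :=
  [/\ forall n, 0 <= p n,
      forall n, n \notin states_at N x -> p n = 0,
      \sum_(n in states_at N x) p n = 1
    & forall n, n \in states_at N x ->
        p n * (\sum_(n' in states_at N x) transition_rate x n n')
        = \sum_(n' in states_at N x) p n' * transition_rate x n' n].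

Definition stationary_distribution (N : nat) (x : 'rV[R]_2) :
    {ffun state N -> R} :=
  xget [ffun=> 0] [set p | is_stationary x p]%classic.

Definition TH (N : nat) (x : 'rV[R]_2) (j : 'I_J.-1) : R :=
  \sum_(n in states N)
    stationary_distribution N x n * station_rate (Some j) (n (warehouse j)).

Definition THw (N : nat) (x : 'rV[R]_2) : R := \sum_j TH N x j.

Definition weber_solution (x : 'rV[R]_2) : Prop :=
  forall y, \sum_j rho j * dist x j <= \sum_j rho j * dist y j.

Definition admissible (N : nat) (x : 'rV[R]_2) : Prop :=
  [/\ (1 <= N)%N,
      forall j, D j <= TH N x j
    & forall y, THw N y <= THw N x].

Definition P_solution (N : nat) (x : 'rV[R]_2) : Prop :=
  admissible N x /\
  forall N' x', admissible N' x' -> THw N x <= THw N' x'.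

End Network.

(* Main.v *)
Require Import Defs.
From mathcomp Require Import all_boot all_order all_algebra.
From mathcomp Require Import all_classical all_reals convex.
From mathcomp Require Import ring zify.

Set Implicit Arguments.
Unset Strict Implicit.
Unset Printing Implicit Defensive.

Import Order.TTheory GRing.Theory Num.Theory.

Local Open Scope ring_scope.

(* The stationary distribution has product form, and the throughput of        *)
(* warehouse j is rho_j G(N-1) / G(N), where G(N) is the coefficient of X^N   *)
(* in the product of the generating functions of the node weights. The travel *)
(* nodes contribute exp(2 W X) with W = sum_j rho_j d_j(x), so that the       *)
(* throughput depends on x only through W. The generating functions are       *)
(* log-concave, a property that is stable under products and becomes strict   *)
(* for a product of two full-support factors (here, two stations). Hence      *)
(* G(N-1) / G(N) is nonincreasing in W and strictly increasing in N. So every *)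
(* Weber point maximizes the total throughput for each N, which gives         *)
(* existence, and distinct N have distinct maximal throughputs, which gives   *)
(* uniqueness.                                                                *)

(** * Log-concave polynomials *)

(** A Weber point does at least as well as any other location for every fleet size: replacing it by
    a costlier location multiplies the generating function of [G] by an exponential with nonnegative
    coefficients, which by log-concavity cannot raise [G(N-1) / G(N)] ([coef_ratio_le],
    [THw_antitone]). Since [TH_THw] makes each warehouse throughput the fixed share [rho j] of the
    total, the demand constraints see only the total throughput. A solution at any location
    therefore carries over to [xstar] with the same [N]. All solutions attain the same minimal
    value, and strict growth in [N] ([THw_lt_succ], [THw_inj]) leaves one [N]. The formula for the
    throughput rests on the product form ([product_form_stationary]) and on its uniqueness
    ([is_stationary_unique]), also when some distances vanish. *)

Lemma cauchy_binet2 (R : comNzRingType) (I : finType) (a b c d : I -> R) :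
  ((\sum_k a k * c k) * (\sum_k b k * d k)
     - (\sum_k a k * d k) * (\sum_k b k * c k)) *+ 2
  = \sum_k \sum_l (a k * b l - a l * b k) * (c k * d l - d k * c l).
Proof.
set X := (_ - _).
have XE : X = \sum_k \sum_l (a k * b l) * (c k * d l - d k * c l).
  rewrite /X !big_distrlr /= -sumrB; apply: eq_bigr => k _.
  by rewrite -sumrB; apply: eq_bigr => l _; ring.
(* Adding the copy of the sum with [k] and [l] swapped antisymmetrizes the first factor. *)
rewrite mulr2n {1}XE XE [X in _ + X]exchange_big -big_split.
apply: eq_bigr => k _; rewrite -big_split.
by apply: eq_bigr => l _ /=; ring.
Qed.

Section LogConcave.
Variable R : realFieldType.
Implicit Types p q : {poly R}.

Definition coef_nneg p := forall n, 0 <= p`_n.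

(* Four-point form of log-concavity; unlike [p`_n * p`_n.+2 <= p`_n.+1 ^+ 2], *)
(* it excludes internal zeros and is therefore stable under products.         *)
Definition log_concave p :=
  forall u g h, p`_u * p`_(u + g + h) <= p`_(u + g) * p`_(u + h).

(* The shifts ['X^k * p] are the columns of the Toeplitz matrix of [p]. *)
Lemma log_concave_minor p n m k l :
    coef_nneg p -> log_concave p -> (n <= m)%N -> (k <= l)%N ->
  ('X^l * p)`_n * ('X^k * p)`_m <= ('X^k * p)`_n * ('X^l * p)`_m.
Proof.
move=> p0 lc nm kl; rewrite !coefXnM.
have [nl|ln] := ltnP n l.
  by rewrite mul0r mulr_ge0 //; case: ifP.
rewrite !ifF; [|lia..].
have := lc (n - l)%N (l - k)%N (m - n)%N.
have -> : (n - l + (l - k) = n - k)%N by lia.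
have -> : (n - k + (m - n) = m - k)%N by lia.
by have -> : (n - l + (m - n) = m - l)%N by lia.
Qed.

(** The Toeplitz matrix of a product is the product of the Toeplitz matrices. The free bound [K]
    lets coefficients of different degrees share one index set, as Cauchy-Binet requires. *)
Lemma coef_shiftM p q n g K : (n < K)%N ->
  ('X^g * (p * q))`_n = \sum_(k < K) ('X^k * p)`_n * ('X^g * q)`_k.
Proof.
move=> nK; rewrite mulrCA coefMr.
rewrite (big_ord_widen K (fun j => p`_(n - j) * ('X^g * q)`_j)) //.
rewrite big_mkcond /=; apply: eq_bigr => k _.
by rewrite [in RHS]coefXnM ltnS leqNgt; case: (n < k)%N; rewrite ?mul0r.
Qed.

Lemma coef_nnegM p q : coef_nneg p -> coef_nneg q -> coef_nneg (p * q).
Proof. by move=> p0 q0 n; rewrite coefM sumr_ge0 // => i _; apply: mulr_ge0. Qed.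

Lemma coef_gt0M p q n : coef_nneg p -> coef_nneg q ->
  0 < p`_n -> 0 < q`_0 -> 0 < (p * q)`_n.
Proof.
move=> p0 q0 pn q00; rewrite coefM (bigD1 ord_max) //= subnn ltr_pwDl ?mulr_gt0 //.
by apply: sumr_ge0 => i _; apply: mulr_ge0.
Qed.

Section BigProduct.
Variables (I : finType) (P : pred I) (F : I -> {poly R}).
Hypothesis F_nneg : forall i, coef_nneg (F i).

Lemma coef_nneg_prod : coef_nneg (\prod_(i | P i) F i).
Proof.
elim/big_ind: _ => [n|p q p0 q0|i _]; last exact: F_nneg.
  by rewrite coef1; case: eqP.
exact: coef_nnegM.
Qed.

Lemma coef0_prod_gt0 : (forall i, 0 < (F i)`_0) -> 0 < (\prod_(i | P i) F i)`_0.
Proof.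
move=> F00; elim/big_ind: _ => [|p q p00 q00|i _]; last exact: F00.
  by rewrite coef1.
by rewrite coef0M mulr_gt0.
Qed.

End BigProduct.

Section Product.
Variables p q : {poly R}.
Hypotheses (p0 : coef_nneg p) (lcp : log_concave p).
Hypotheses (q0 : coef_nneg q) (lcq : log_concave q).

Let minors r t g (K : nat) (k l : 'I_K) :=
  (('X^k * p)`_r * ('X^l * p)`_t - ('X^l * p)`_r * ('X^k * p)`_t)
   * (('X^0 * q)`_k * ('X^g * q)`_l - ('X^g * q)`_k * ('X^0 * q)`_l).

Let minors_ge0 r t g (K : nat) (k l : 'I_K) : (r <= t)%N ->
  0 <= minors r t g k l.
Proof.
move=> rt; rewrite /minors; case: (leqP k l) => kl.
  apply: mulr_ge0; rewrite subr_ge0.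
    exact: log_concave_minor.
  exact: log_concave_minor.
(* For [l < k] both minors change sign, so their product stays nonnegative. *)
rewrite -mulrNN !opprB; apply: mulr_ge0; rewrite subr_ge0.
  by apply: log_concave_minor => //; apply: ltnW.
rewrite [leRHS]mulrC [leLHS]mulrC.
by apply: log_concave_minor => //; apply: ltnW.
Qed.

(** Cauchy-Binet for the minor of the matrix of [p * q] with rows [u + g], [u + g + h] and columns
    [0], [g]. Ordered pairs [(k, l)] count every term twice. *)
Let minors_sum u g h :
  ((p * q)`_(u + g) * (p * q)`_(u + h) - (p * q)`_u * (p * q)`_(u + g + h)) *+ 2
  = \sum_(k < (u + g + h).+1) \sum_(l < (u + g + h).+1)
      minors (u + g) (u + g + h) g k l.
Proof.
rewrite -(@cauchy_binet2 _ _ (fun k : 'I_(u + g + h).+1 => ('X^k * p)`_(u + g))).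
rewrite -!coef_shiftM //; [|lia..].
rewrite expr0 !mul1r !coefXnM !ifF; [|lia..].
have -> : (u + g + h - g = u + h)%N by lia.
by have -> : (u + g - g = u)%N by lia.
Qed.

Lemma log_concaveM : log_concave (p * q).
Proof.
move=> u g h; rewrite -subr_ge0 -(pmulrn_lge0 _ (isT : 0 < 2)%N) minors_sum.
apply: sumr_ge0 => k _; apply: sumr_ge0 => l _; apply: minors_ge0; lia.
Qed.

(* The minor at rows [k = 0] and [l = n.+2] is [p_(n+1) p_0 q_0 q_(n+1)]. *)
Lemma log_concaveM_strict n :
    0 < p`_0 -> 0 < p`_n.+1 -> 0 < q`_0 -> 0 < q`_n.+1 ->
  (p * q)`_n * (p * q)`_n.+2 < (p * q)`_n.+1 * (p * q)`_n.+1.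
Proof.
move=> p00 pn q00 qn; rewrite -subr_gt0 -(pmulrn_lgt0 _ (isT : 0 < 2)%N).
have := minors_sum n 1 1; rewrite !addn1 => ->.
rewrite (bigD1 ord0) //= (bigD1 ord_max) //=.
apply: ltr_wpDr; first by apply: sumr_ge0 => k _; apply: sumr_ge0 => l _; apply: minors_ge0.
apply: ltr_wpDr; first by apply: sumr_ge0 => l _; apply: minors_ge0.
rewrite /minors /= !coefXnM !subnn !subn0 !subn1 !ltnn !ltnS !ltn0 /= leqnn.
by rewrite !mul0r !subr0 !mulr_gt0.
Qed.

End Product.

Lemma log_concave_prod (I : finType) (P : pred I) (F : I -> {poly R}) :
    (forall i, coef_nneg (F i)) -> (forall i, log_concave (F i)) ->
  log_concave (\prod_(i | P i) F i).
Proof.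
move=> F0 lcF.
suff [] : coef_nneg (\prod_(i | P i) F i) /\ log_concave (\prod_(i | P i) F i) by [].
elim/big_ind: _ => [|p q [p0 lcp] [q0 lcq]|i _]; last by split.
  split=> [n|u [|g] h]; first by rewrite coef1; case: eqP.
    by rewrite !addn0.
  by rewrite !coef1 !addnS !addSn /= mulr0 mul0r.
by split; [exact: coef_nnegM|exact: log_concaveM].
Qed.

(** Holds term by term in the coefficients of [q], by log-concavity of [p] at [n - k], [n],
    [n.+1 - k], [n.+1]; the term of [q] in degree [n.+1] occurs only on the right. *)
Lemma coef_ratio_le p q n : coef_nneg p -> log_concave p -> coef_nneg q ->
  (p * q)`_n * p`_n.+1 <= p`_n * (p * q)`_n.+1.
Proof.
move=> p0 lcp q0; rewrite !coefMr mulr_suml mulr_sumr [leRHS]big_ord_recr /=.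
apply: ler_wpDr; first by rewrite !mulr_ge0.
apply: ler_sum => k _; rewrite mulrAC mulrA ler_wpM2r //.
have := lcp (n - k)%N 1%N k.
have -> : (n - k + 1 = n.+1 - k)%N by have := ltn_ord k; lia.
have -> : (n.+1 - k + k = n.+1)%N by have := ltn_ord k; lia.
have -> : (n - k + k = n)%N by have := ltn_ord k; lia.
by rewrite [X in _ <= X -> _]mulrC.
Qed.

End LogConcave.

(** * Power series truncated at order [M] *)

Section Truncation.
Variable R : comNzRingType.

Definition coef_eq_lt (M : nat) (p q : {poly R}) :=
  forall k, (k < M)%N -> p`_k = q`_k.

Lemma coef_eq_ltM M p p' q q' : coef_eq_lt M p p' -> coef_eq_lt M q q' ->
  coef_eq_lt M (p * q) (p' * q').
Proof.
move=> pp qq k kM; rewrite !coefM; apply: eq_bigr => i _.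
by rewrite pp ?qq //; have := ltn_ord i; lia.
Qed.

Lemma coef_eq_lt_prod M (I : finType) (F F' : I -> {poly R}) :
  (forall i, coef_eq_lt M (F i) (F' i)) ->
  coef_eq_lt M (\prod_i F i) (\prod_i F' i).
Proof.
move=> FF; elim/big_ind2: _ => [||i _]; [by []| |exact: FF].
by move=> *; apply: coef_eq_ltM.
Qed.

Lemma coef_prod_poly N M (I : finType) (f : I -> nat -> R) :
  (\prod_i \poly_(n < M) f i n)`_N =
  \sum_(n : {ffun I -> 'I_M} | (\sum_i n i)%N == N) \prod_i f i (n i).
Proof.
under eq_bigr do rewrite poly_def.
rewrite bigA_distr_bigA /= coef_sum [RHS]big_mkcond /=; apply: eq_bigr => n _.
under eq_bigr do rewrite -mul_polyC.
rewrite big_split /= -rmorph_prod /= coefCM -expr_sum /= coefXn eq_sym.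
by case: eqP; rewrite ?mulr1 ?mulr0.
Qed.

End Truncation.

Section Exponential.
Variable R : realFieldType.

Definition exp_poly M (t : R) := \poly_(n < M) (t ^+ n / n`!%:R).

Lemma exp_polyD M (t u : R) :
  coef_eq_lt M (exp_poly M t * exp_poly M u) (exp_poly M (t + u)).
Proof.
move=> k kM; rewrite coefMr coef_poly kM exprDn mulr_suml; apply: eq_bigr => i _.
rewrite !coef_poly !ifT; [|by have := ltn_ord i; lia..].
have le_ik : (i <= k)%N by rewrite -ltnS.
have /(congr1 (fun n => n%:R : R)) := bin_fact le_ik.
rewrite !natrM => E.
have f0 n : n`!%:R != 0 :> R by rewrite pnatr_eq0 -lt0n fact_gt0.
rewrite -E -mulr_natr; have := f0 i; have := f0 (k - i)%N.
have : 'C(k, i)%:R != 0 :> R by rewrite pnatr_eq0 -lt0n bin_gt0.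
move=> *; field; by apply/and3P.
Qed.

Lemma exp_poly_sum M (I : finType) (t : I -> R) :
  coef_eq_lt M (\prod_i exp_poly M (t i)) (exp_poly M (\sum_i t i)).
Proof.
elim/big_ind2: _ => [k kM|p t1 q t2 E1 E2 k kM|//].
  by rewrite coef_poly kM coef1; case: k kM => [|k] _; rewrite ?expr0 ?divr1 // expr0n mul0r.
by rewrite (coef_eq_ltM E1 E2) // exp_polyD.
Qed.

End Exponential.

Section Weights.
Variables (R : realFieldType) (f : nat -> R).
Hypothesis f0 : forall n, 0 <= f n.

Lemma poly_prod_nneg M : coef_nneg (\poly_(n < M) \prod_(l < n) f l).
Proof. by move=> n; rewrite coef_poly; case: ifP => // _; apply: prodr_ge0. Qed.

(** After the common factors cancel, [g] consecutive values of [f] starting at [u + h] are compared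
    with [g] values starting at [u]. *)
Lemma poly_prod_log_concave M : (forall m n, (m <= n)%N -> f n <= f m) ->
  log_concave (\poly_(n < M) \prod_(l < n) f l).
Proof.
move=> f_le u g h; rewrite !coef_poly.
case: (ltnP (u + g + h) M) => ughM; last first.
  by rewrite mulr0; apply: mulr_ge0; case: ifP => // _; apply: prodr_ge0.
rewrite !ifT; [|lia..].
have -> : (u + g + h = u + h + g)%N by lia.
rewrite [X in _ * X]big_split_ord [X in _ <= X * _]big_split_ord /=.
rewrite mulrCA mulrA [leRHS]mulrAC.
rewrite [X in _ <= X * _]mulrC ler_wpM2l //; first by rewrite mulr_ge0 ?prodr_ge0.
by apply: ler_prod => l _; rewrite f0 f_le //; lia.
Qed.

End Weights.

(** * Jumps between states *)

Lemma big_option_type (V : Type) (idx : V) (op : Monoid.com_law idx) (I : finType)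
    (F : option I -> V) :
  \big[op/idx]_k F k = op (F None) (\big[op/idx]_j F (Some j)).
Proof.
rewrite (bigD1 None) //=; congr (op _ _).
rewrite (reindex_omap Some id) /=; first by apply: eq_bigl => j; rewrite eqxx.
by case.
Qed.

Lemma big_node (V : Type) (idx : V) (op : Monoid.com_law idx) J (F : node J -> V) :
  \big[op/idx]_i F i =
  op (op (F center) (\big[op/idx]_j F (warehouse j)))
     (op (\big[op/idx]_j F (outbound j)) (\big[op/idx]_j F (inbound j))).
Proof. by rewrite !big_sumType big_option_type. Qed.

Section Jumps.
Variables (J N : nat).
Implicit Types n : state J N.

Lemma jump_sym n i k n' : jump n i k n' = jump n' k i n.
Proof.
have E m : (n' m + (m == i) == n m + (m == k))%N = (n m + (m == k) == n' m + (m == i))%N.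
  by rewrite eq_sym.
rewrite /jump; under eq_forallb do rewrite E.
case: forallP => [H|]; last by rewrite !andbF.
rewrite !andbT; have /eqP := H i; have /eqP := H k; rewrite !eqxx (eq_sym k).
by have [->|_] := eqVneq i k => /=; lia.
Qed.

Lemma jump_states n i k n' : n \in states J N -> jump n i k n' -> n' \in states J N.
Proof.
rewrite !inE => /eqP nN /andP[_ /forallP H]; apply/eqP.
have : (\sum_m (n' m + (m == i)) = \sum_m (n m + (m == k)))%N.
  by apply: eq_bigr => m _; apply/eqP.
rewrite !big_split /= nN.
have S1 (l : node J) : (\sum_m (m == l) = 1)%N.
  by rewrite (bigD1 l) //= eqxx big1 // => m /negPf ->.
by rewrite !S1 => /addIn.
Qed.

Lemma jump_inj n i k n1 n2 : jump n i k n1 -> jump n i k n2 -> n1 = n2.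
Proof.
move=> /andP[_ /forallP H1] /andP[_ /forallP H2]; apply/ffunP => m; apply: val_inj.
by apply/eqP; rewrite -(eqn_add2r (m == i)) (eqP (H1 m)) (eqP (H2 m)).
Qed.

Lemma jump_trans n i k l n1 n2 : jump n i k n1 -> jump n i l n2 -> jump n1 k l n2.
Proof.
move=> nn1 /andP[_ /forallP H2]; have /andP[_ /forallP H1] := nn1.
move: nn1; rewrite jump_sym => /andP[n1k _]; rewrite /jump n1k andTb.
apply/forallP => m; apply/eqP; have /eqP := H1 m; have /eqP := H2 m.
by move: (m == i : nat) (m == k : nat) (m == l : nat) => *; lia.
Qed.

Lemma jump_exists n i k : n \in states J N -> (0 < n i)%N ->
  exists n', jump n i k n'.
Proof.
rewrite inE => /eqP nN ni.
exists [ffun m => inord (n m + (m == k) - (m == i))%N].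
rewrite /jump ni; apply/forallP => m; rewrite ffunE inordK.
  apply/eqP; have [->|_] := eqVneq m i; first by rewrite subnK // (leq_trans ni) ?leq_addr.
  by rewrite subn0 addn0.
have := ltn_ord (n m); have [->|mi] := eqVneq m i => /=; first by case: (i == k) => /=; lia.
have [mk|_] := eqVneq m k => /=; last by lia.
(* The truck at [i] guarantees that one more truck at [m] still fits in ['I_N.+1]. *)
have : (n m + n i <= N)%N.
  rewrite -[leqRHS]nN (bigD1 m) //= leq_add2l (bigD1 i) 1?eq_sym //=; exact: leq_addr.
by move=> le_nN _; rewrite subn0 ltnS (leq_trans _ le_nN) ?leq_add2l.
Qed.

End Jumps.

(** * Product form and throughputs *)

Section Equilibrium.
Variables (R : realType) (J : nat) (a : 'I_J.-1 -> 'rV[R]_2) (D : 'I_J.-1 -> R).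
Variables (d : 'rV[R]_2 * 'rV[R]_2 -> R) (s : station J -> nat) (mu : station J -> R).
Hypothesis J_ge2 : (2 <= J)%N.
Hypothesis D_gt0 : forall j, 0 < D j.
Hypothesis d_ge0 : forall z, 0 <= d z.
Hypothesis s_ge1 : forall k, (1 <= s k)%N.
Hypothesis mu_gt0 : forall k, 0 < mu k.

(** * Routing and traffic equations *)

Lemma sum_demand_gt0 : 0 < \sum_k D k.
Proof.
have j : 'I_J.-1 by exists 0%N; lia.
rewrite (bigD1 j) //=; apply: ltr_pwDl => //.
by apply: sumr_ge0 => k _; apply: ltW.
Qed.

Lemma rho_gt0 j : 0 < rho D j.
Proof. by rewrite divr_gt0 ?sum_demand_gt0. Qed.

Lemma sum_rho : \sum_j rho D j = 1.
Proof. by rewrite -mulr_suml divff ?gt_eqF ?sum_demand_gt0. Qed.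

Lemma routing_row i : \sum_k routing D i k = 1.
Proof.
have sum_delta j : \sum_(l < J.-1) (j == l)%:R = 1 :> R.
  by rewrite (bigD1 j) //= eqxx big1 ?addr0 // => l; rewrite eq_sym => /negPf ->.
by rewrite big_node; case: i => [[j|]|[j|j]] /=;
  rewrite ?sum_rho ?sum_delta ?big1_eq ?addr0 ?add0r.
Qed.

Definition visit_ratio (i : node J) : R :=
  match i with
  | center => 1
  | warehouse j | outbound j | inbound j => rho D j
  end.

Lemma visit_ratio_gt0 i : 0 < visit_ratio i.
Proof. by case: i => [[j|]|[j|j]] //=; apply: rho_gt0. Qed.

Lemma routing_ge0 i k : 0 <= routing D i k.
Proof. by case: i k => [[j|]|[j|j]] [[l|]|[l|l]] //=; apply/ltW/rho_gt0. Qed.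

Lemma traffic_equation k : \sum_i visit_ratio i * routing D i k = visit_ratio k.
Proof.
have sum_delta j : \sum_(l < J.-1) rho D l * (l == j)%:R = rho D j.
  by rewrite (bigD1 j) //= eqxx mulr1 big1 ?addr0 // => l /negPf ->; rewrite mulr0.
have sum0 : \sum_(l < J.-1) rho D l * 0 = 0 by rewrite big1 // => l _; rewrite mulr0.
have sum1 : \sum_(l < J.-1) rho D l * 1 = 1.
  by rewrite -[RHS]sum_rho; apply: eq_bigr => l _; rewrite mulr1.
rewrite big_node; case: k => [[j|]|[j|j]] /=;
  by rewrite ?sum_delta ?sum0 ?sum1 ?mul1r ?mulr0 ?addr0 ?add0r.
Qed.

Section Location.
Variable x : 'rV[R]_2.

Local Notation inst := (instantaneous a d x).
Local Notation rate := (service_rate a d s mu x).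
Local Notation route := (routing_at a D d x).
Local Notation dst := (dist a d x).

Lemma dist_ge0 j : 0 <= dst j.
Proof. exact: d_ge0. Qed.

Lemma routing_inst i k : inst i -> inst k -> routing D i k = 0.
Proof. by case: i k => [[j|]|[j|j]] [[l|]|[l|l]]. Qed.

Lemma routing_at_ge0 i k : 0 <= route i k.
Proof.
rewrite /routing_at; case: ifP => // _; apply: addr_ge0; first exact: routing_ge0.
by apply: sumr_ge0 => m _; apply: mulr_ge0; apply: routing_ge0.
Qed.

Lemma routing_at_row i : \sum_k route i k = 1.
Proof.
rewrite -(routing_row i) /routing_at (bigID inst) /= big1 ?add0r; last by move=> k ->.
rewrite [RHS](bigID inst) /= addrC.
under eq_bigr => k /negPf -> do [].
rewrite big_split /=; congr (_ + _).
rewrite exchange_big /=; apply: eq_bigr => m m_inst.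
rewrite -mulr_sumr -[RHS]mulr1; congr (_ * _).
rewrite -(routing_row m) [RHS](bigID inst) /= [X in _ = X + _]big1 ?add0r // => k.
exact: routing_inst.
Qed.

(** Bypassing instantaneous nodes keeps the visit ratios of the others: the flow through a bypassed
    [m] is [visit_ratio m] by its own traffic equation, and none of it comes from another
    instantaneous node. *)
Lemma traffic_equation_at k : ~~ inst k ->
  \sum_(i | ~~ inst i) visit_ratio i * route i k = visit_ratio k.
Proof.
move=> /negPf k_act; rewrite -[RHS]traffic_equation [RHS](bigID inst) /= addrC.
under eq_bigr do rewrite /routing_at k_act mulrDr mulr_sumr.
rewrite big_split /=; congr (_ + _).
rewrite exchange_big /=; apply: eq_bigr => m m_inst.
under eq_bigr do rewrite mulrA.
rewrite -mulr_suml; congr (_ * _).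
rewrite -[RHS]traffic_equation [RHS](bigID inst) /= [X in _ = X + _]big1 ?add0r // => i i_inst.
by rewrite routing_inst ?mulr0.
Qed.

Lemma routing_le_routing_at i k : ~~ inst k -> routing D i k <= route i k.
Proof.
move=> /negPf k_act; rewrite /routing_at k_act ler_wpDr //.
by apply: sumr_ge0 => m _; apply: mulr_ge0; apply: routing_ge0.
Qed.

Lemma routing_through_le_routing_at i m k : inst m -> ~~ inst k ->
  routing D i m * routing D m k <= route i k.
Proof.
move=> m_inst /negPf k_act; rewrite /routing_at k_act (bigD1 m) //= addrCA ler_wpDr //.
apply: addr_ge0; first exact: routing_ge0.
by apply: sumr_ge0 => l _; apply: mulr_ge0; apply: routing_ge0.
Qed.

Lemma routing_at_outbound j : dst j != 0 -> 0 < route center (outbound j).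
Proof.
by move=> dj; apply: lt_le_trans (routing_le_routing_at _ _) => //; apply: rho_gt0.
Qed.

Lemma routing_at_warehouse j :
  0 < route (if dst j == 0 then center else outbound j) (warehouse j).
Proof.
case: ifP => dj; last first.
  by apply: lt_le_trans (routing_le_routing_at _ _); rewrite //= eqxx.
apply: lt_le_trans (routing_through_le_routing_at _ (dj : inst (outbound j)) _) => //=.
by rewrite eqxx mulr1 rho_gt0.
Qed.

Lemma routing_at_inbound j : dst j != 0 -> 0 < route (warehouse j) (inbound j).
Proof.
by move=> dj; apply: lt_le_trans (routing_le_routing_at _ _) => //=; rewrite eqxx.
Qed.

Lemma routing_at_center j :
  0 < route (if dst j == 0 then warehouse j else inbound j) center.
Proof.
case: ifP => dj; last by apply: lt_le_trans (routing_le_routing_at _ _).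
apply: lt_le_trans (routing_through_le_routing_at _ (dj : inst (inbound j)) _) => //=.
by rewrite eqxx mulr1.
Qed.

Lemma service_rate_ge0 i n : 0 <= rate i n.
Proof.
case: i => [k|[j|j]] /=; first by rewrite mulr_ge0 // ltW.
  by rewrite divr_ge0 ?dist_ge0.
by rewrite divr_ge0 ?dist_ge0.
Qed.

Lemma service_rate0 i : rate i 0 = 0.
Proof. by case: i => [k|[j|j]] /=; rewrite ?mul0r // /station_rate min0n mulr0. Qed.

Lemma service_rate_gt0 i n : ~~ inst i -> (0 < n)%N -> 0 < rate i n.
Proof.
case: i => [k|[j|j]] /= i_act n_gt0.
- by rewrite mulr_gt0 // ltr0n leq_min n_gt0 s_ge1.
- by rewrite divr_gt0 ?ltr0n // lt_def i_act dist_ge0.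
- by rewrite divr_gt0 ?ltr0n // lt_def i_act dist_ge0.
Qed.

Lemma service_rate_inst i n : inst i -> rate i n = 0.
Proof. by case: i => [k|[j|j]] //= /eqP ->; rewrite invr0 mulr0. Qed.

Lemma service_rate_le i m n : (m <= n)%N -> rate i m <= rate i n.
Proof.
move=> mn; case: i => [k|[j|j]] /=.
- by rewrite ler_pM2l // ler_nat leq_min geq_minr (leq_trans (geq_minl _ _)).
- by rewrite ler_wpM2r ?invr_ge0 ?dist_ge0 // ler_nat.
- by rewrite ler_wpM2r ?invr_ge0 ?dist_ge0 // ler_nat.
Qed.

(** * Product-form weights and balance equations *)

Definition load i n : R := visit_ratio i / rate i n.+1.

(* At an instantaneous node the service rate is [0], hence so is its junk     *)
(* inverse, and the weight is [1] when the node is empty and [0] otherwise.   *)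
Definition node_weight i n : R := \prod_(l < n) load i l.

Lemma load_ge0 i n : 0 <= load i n.
Proof. by rewrite divr_ge0 ?service_rate_ge0 // ltW ?visit_ratio_gt0. Qed.

Lemma load_le i m n : (m <= n)%N -> load i n <= load i m.
Proof.
move=> mn; rewrite ler_wpM2l ?(ltW (visit_ratio_gt0 _)) //.
have [i_inst|i_act] := boolP (inst i); first by rewrite !service_rate_inst.
by rewrite lef_pV2 ?posrE ?service_rate_gt0 // service_rate_le.
Qed.

Lemma node_weight_ge0 i n : 0 <= node_weight i n.
Proof. by apply: prodr_ge0 => l _; apply: load_ge0. Qed.

Lemma node_weight_gt0 i n : ~~ inst i -> 0 < node_weight i n.
Proof.
move=> i_act; apply: prodr_gt0 => l _.
by rewrite divr_gt0 ?visit_ratio_gt0 ?service_rate_gt0.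
Qed.

Lemma node_weight_inst i n : inst i -> (0 < n)%N -> node_weight i n = 0.
Proof.
case: n => // n i_inst _; rewrite /node_weight big_ord_recl /load.
by rewrite service_rate_inst // invr0 mulr0 mul0r.
Qed.

Lemma node_weight_rec i n : ~~ inst i ->
  node_weight i n.+1 * rate i n.+1 = visit_ratio i * node_weight i n.
Proof.
move=> i_act; rewrite /node_weight big_ord_recr /= -mulrA mulfVK 1?mulrC //.
by rewrite gt_eqF ?service_rate_gt0.
Qed.

Definition gen_fun M i : {poly R} := \poly_(n < M) node_weight i n.
(** The Gordon-Newell constant [G(N)]. The truncation order [M] is kept separate from [N] so that
    consecutive constants can be read off one polynomial. *)
Definition norm_const M N : R := (\prod_i gen_fun M i)`_N.

Section Population.
Variable N : nat.
Implicit Types n : state J N.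

Definition weight n : R := \prod_i node_weight i (n i).

Lemma weight_ge0 n : 0 <= weight n.
Proof. by apply: prodr_ge0 => i _; apply: node_weight_ge0. Qed.

Lemma states_atP n :
  reflect (n \in states J N /\ forall i, inst i -> n i = 0%N :> nat) (n \in states_at a d N x).
Proof.
rewrite [n \in states_at _ _ _ _]finset.in_set; apply: (iffP andP) => -[nS H]; split=> //.
  by move=> i i_inst; have /forallP/(_ i) := H; rewrite i_inst => /eqP.
by apply/forallP => i; apply/implyP => i_inst; rewrite H.
Qed.

Lemma states_at_active n i : n \in states_at a d N x -> (0 < n i)%N -> ~~ inst i.
Proof. by move=> /states_atP[_ H]; apply: contraTN => /H ->. Qed.

Lemma weight_gt0 n : n \in states_at a d N x -> 0 < weight n.
Proof.
move=> nS; apply: prodr_gt0 => i _; case: (posnP (n i)) => [->|ni].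
  by rewrite /node_weight big_ord0.
by apply: node_weight_gt0; apply: states_at_active nS ni.
Qed.

Lemma weight_eq0 n : n \in states J N -> n \notin states_at a d N x -> weight n = 0.
Proof.
rewrite [n \in states_at _ _ _ _]finset.in_set => -> /= /forallPn[i].
rewrite negb_imply -lt0n => /andP[i_inst ni].
by rewrite /weight (bigD1 i) //= node_weight_inst ?mul0r.
Qed.

Lemma jump_states_at n i k n' : n \in states_at a d N x -> ~~ inst k ->
  jump n i k n' -> n' \in states_at a d N x.
Proof.
move=> /states_atP[nS H] k_act nn'; apply/states_atP; split; first exact: jump_states nn'.
move=> m m_inst; have /andP[_ /forallP/(_ m)/eqP] := nn'; rewrite H //.
have /negPf-> : m != k by apply: contraNneq k_act => <-.
by move=> /eqP; rewrite addn_eq0 => /andP[/eqP].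
Qed.

(* The product over [m] is common to both sides of a jump. *)
Lemma weight_rate n k : ~~ inst k -> (0 < n k)%N ->
  weight n * rate k (n k) = visit_ratio k * \prod_m node_weight m (n m - (m == k)).
Proof.
move=> k_act nk; rewrite /weight (bigD1 k) //= [in RHS](bigD1 k) //= eqxx subn1 mulrA.
rewrite -(prednK nk) -node_weight_rec // mulrAC; congr (_ * _).
by apply: eq_bigr => m /negPf ->; rewrite subn0.
Qed.

(** Removing the moving truck from [i] in [n], or from [k] in [n'], leaves the same
    configuration. *)
Lemma weight_jump n i k n' : ~~ inst i -> ~~ inst k -> jump n i k n' ->
  visit_ratio k * (weight n * rate i (n i)) = visit_ratio i * (weight n' * rate k (n' k)).
Proof.
move=> i_act k_act nn'; have := nn'; rewrite jump_sym => /andP[n'k _].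
have /andP[ni /forallP H] := nn'; rewrite !weight_rate // mulrCA; congr (_ * (_ * _)).
apply: eq_bigr => m _; congr node_weight; have /eqP := H m.
have [mi|_] := eqVneq m i; have [mk|_] := eqVneq m k; subst=> /=; lia.
Qed.

Lemma sum_jumps n i k (F : state J N -> R) (c : R) :
    n \in states_at a d N x -> ~~ inst k -> (0 < n i)%N ->
    (forall n', jump n i k n' -> F n' = c) ->
  \sum_(n' in states_at a d N x | jump n i k n') F n' = c.
Proof.
move=> nS k_act ni Fc; have /states_atP[nS0 _] := nS.
have [n' nn'] := jump_exists k nS0 ni.
rewrite (big_pred1 n') ?Fc // => n'' /=; apply/andP/eqP => [[_ H]|->].
  exact: jump_inj H nn'.
by split=> //; apply: jump_states_at nn'.
Qed.

Lemma outflow n : n \in states_at a d N x ->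
  \sum_(n' in states_at a d N x) transition_rate a D d s mu x n n'
  = \sum_i rate i (n i).
Proof.
move=> nS; rewrite /transition_rate exchange_big /=; apply: eq_bigr => i _.
rewrite (exchange_big_dep predT) //=.
case: (posnP (n i)) => [->|ni].
  by rewrite service_rate0 big1 // => k _; rewrite big1 // => n' _; rewrite mul0r.
rewrite -[RHS]mulr1 -(routing_at_row i) mulr_sumr; apply: eq_bigr => k _.
have [k_inst|k_act] := boolP (inst k).
  by rewrite /routing_at k_inst mulr0 big1.
exact: sum_jumps.
Qed.

(** Balance holds node by node: for each [k], [weight_jump] turns the flow of arrivals at [k] into
    the departure flow from [k] times a traffic-equation sum. *)
Lemma inflow n : n \in states_at a d N x ->
  \sum_(n' in states_at a d N x) weight n' * transition_rate a D d s mu x n' n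
  = weight n * \sum_k rate k (n k).
Proof.
move=> nS; rewrite /transition_rate.
under eq_bigr => n' _ do rewrite mulr_sumr; rewrite exchange_big /=.
under eq_bigr => i _ do under eq_bigr => n' _ do rewrite mulr_sumr.
under eq_bigr => i _ do rewrite (exchange_big_dep predT) //=.
rewrite exchange_big /= mulr_sumr; apply: eq_bigr => k _.
case: (posnP (n k)) => [nk0|nk].
  rewrite nk0 service_rate0 mulr0 big1 // => i _; rewrite big1 // => n' /andP[_].
  by rewrite jump_sym /jump nk0.
have k_act := states_at_active nS nk.
rewrite (bigID inst) /= [X in X + _]big1 ?add0r; last first.
  move=> i i_inst; rewrite big1 // => n' /andP[n'S /andP[n'i _]].
  by have /negP := states_at_active n'S n'i.
have vk : visit_ratio k != 0 by rewrite gt_eqF ?visit_ratio_gt0.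
apply: (mulfI vk); rewrite -[in RHS](traffic_equation_at k_act) mulr_suml mulr_sumr.
apply: eq_bigr => i i_act; under eq_bigl => n' do rewrite jump_sym.
pose c := visit_ratio i / visit_ratio k * (weight n * rate k (n k)) * route i k.
rewrite (sum_jumps (c := c)) // /c.
  by field.
move=> n'; rewrite jump_sym => n'n; apply: (mulfI vk).
rewrite !mulrA -[visit_ratio k * _ * _]mulrA (weight_jump _ _ n'n) //.
by field.
Qed.


Lemma sum_weight : \sum_(n in states J N) weight n = norm_const N.+1 N.
Proof. by rewrite /norm_const coef_prod_poly; apply: eq_bigl => n; rewrite inE. Qed.

Lemma sum_weight_at : \sum_(n in states_at a d N x) weight n = norm_const N.+1 N.
Proof.
rewrite -sum_weight [RHS](big_setID (states_at a d N x)) /= [X in _ = _ + X]big1 ?addr0.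
  by apply: eq_bigl => n; rewrite finset.in_setI andb_idl // => /states_atP[].
by move=> n; rewrite finset.in_setD => /andP[nS' nS]; apply: weight_eq0.
Qed.

Lemma transition_rate_ge0 n n' : 0 <= transition_rate a D d s mu x n n'.
Proof.
apply: sumr_ge0 => i _; apply: sumr_ge0 => k _.
by rewrite mulr_ge0 ?service_rate_ge0 ?routing_at_ge0.
Qed.

Lemma transition_rate_gt0 n i k n' : ~~ inst i -> 0 < route i k -> jump n i k n' ->
  0 < transition_rate a D d s mu x n n'.
Proof.
move=> i_act ik nn'; rewrite /transition_rate (bigD1 i) //= (bigD1 k) //=.
have /andP[ni _] := nn'.
rewrite -addrA ltr_pwDl ?mulr_gt0 ?service_rate_gt0 //.
apply: addr_ge0; last apply: sumr_ge0 => m _;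
  by apply: sumr_ge0 => l _; rewrite mulr_ge0 ?service_rate_ge0 ?routing_at_ge0.
Qed.

(** * Irreducibility and uniqueness of the stationary distribution *)

Section ZeroSet.
Variable r : state J N -> R.
Hypothesis r_ge0 : forall n, n \in states_at a d N x -> 0 <= r n.
Hypothesis r_balance : forall n, n \in states_at a d N x ->
  r n * (\sum_(n' in states_at a d N x) transition_rate a D d s mu x n n')
  = \sum_(n' in states_at a d N x) r n' * transition_rate a D d s mu x n' n.

Definition spreads i k := forall n n', n \in states_at a d N x -> r n = 0 ->
  jump n i k n' -> r n' = 0.

(* The zeros of a nonnegative solution of the balance equations are closed    *)
(* under predecessors, so they spread against the direction of the routing.   *)
Lemma spreads_back i k : ~~ inst i -> ~~ inst k -> 0 < route k i -> spreads i k.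
Proof.
move=> i_act k_act ki n n' nS rn nn'.
have n'S := jump_states_at nS k_act nn'.
have := r_balance nS; rewrite rn mul0r => /esym.
move/(psumr_eq0P (fun m mS => mulr_ge0 (r_ge0 mS) (transition_rate_ge0 m n))).
move/(_ n' n'S)/eqP; rewrite mulf_eq0 => /orP[/eqP //|/eqP tr0].
have := @transition_rate_gt0 n' k i n k_act ki.
by rewrite jump_sym nn' tr0 ltxx => /(_ isT).
Qed.

Lemma spreads_trans i k l : ~~ inst k -> spreads i k -> spreads k l -> spreads i l.
Proof.
move=> k_act ik kl n n' nS rn nn'; have /andP[ni _] := nn'.
have /states_atP[nS0 _] := nS; have [n1 nn1] := jump_exists k nS0 ni.
have n1S := jump_states_at nS k_act nn1.
exact: kl n1S (ik _ _ nS rn nn1) (jump_trans nn1 nn').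
Qed.

Lemma spreads_warehouse_center j : spreads (warehouse j) center.
Proof.
have := routing_at_warehouse j; case: ifPn => dj H; first exact: spreads_back.
apply: (spreads_trans (k := outbound j)) => //; apply: spreads_back => //.
exact: routing_at_outbound.
Qed.

Lemma spreads_center_warehouse j : spreads center (warehouse j).
Proof.
have := routing_at_center j; case: ifPn => dj H; first exact: spreads_back.
apply: (spreads_trans (k := inbound j)) => //; apply: spreads_back => //.
exact: routing_at_inbound.
Qed.

Lemma spreads_center i : ~~ inst i -> spreads i center.
Proof.
case: i => [[j|]|[j|j]] i_act.
- exact: spreads_warehouse_center.
- move=> n n' nS rn nn'; rewrite -(@jump_inj _ _ n center center n n') //.
  by move: nn' => /andP[nc _]; rewrite /jump nc /=; apply/forallP.
- by apply: spreads_back => //; apply: routing_at_outbound.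
- apply: (spreads_trans (k := warehouse j) _ _ (@spreads_warehouse_center j)) => //.
  by apply: spreads_back => //; apply: routing_at_inbound.
Qed.

Lemma center_spreads i : ~~ inst i -> spreads center i.
Proof.
case: i => [[j|]|[j|j]] i_act.
- exact: spreads_center_warehouse.
- exact: spreads_center.
- apply: (spreads_trans (k := warehouse j) _ (@spreads_center_warehouse j)) => //.
  by apply: spreads_back => //; have := routing_at_warehouse j; rewrite ifN.
- by apply: spreads_back => //; have := routing_at_center j; rewrite ifN.
Qed.

(** Induction on the total excess of [n] over [m]. If they differ, some [k] has too many trucks in
    [m] and some [i] too few; moving one from [k] to [i] by way of the center preserves the zero and
    lowers the excess. *)
Lemma spreads_everywhere n m :
  n \in states_at a d N x -> m \in states_at a d N x -> r m = 0 -> r n = 0.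
Proof.
move=> nS; have [h] := ubnP (\sum_i (n i - m i))%N.
elim: h m => // h IHh m nm_h mS rm.
have [/forallP nm|/forallPn[i]] := boolP [forall i, (n i <= m i)%N]; last rewrite -ltnNge => mi.
  suff -> : n = m by [].
  have /states_atP[] := nS; have /states_atP[] := mS; rewrite !inE => /eqP mN _ /eqP nN _.
  apply/ffunP => i; apply/val_inj/eqP; move: (nN); rewrite -[X in _ = X -> _]mN => /eqP.
  by rewrite (leqif_sum (fun i _ => leqif_eq (nm i))) => /forallP/(_ i).
have [k nk] : exists k, (n k < m k)%N.
  apply/existsP; rewrite -[X in is_true X]negbK negb_exists; apply/forallP => mn.
  have /states_atP[] := nS; have /states_atP[] := mS; rewrite !inE => /eqP mN _ /eqP nN _.
  have {}mn l : (m l <= n l)%N by rewrite leqNgt.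
  have /eqP := nN; rewrite -[X in _ == X]mN eq_sym.
  rewrite (leqif_sum (fun i _ => leqif_eq (mn i))) => /forallP/(_ i).
  by rewrite (ltn_eqF mi).
have mk : (0 < m k)%N by apply: leq_ltn_trans nk.
have i_act : ~~ inst i by apply: states_at_active nS _; apply: leq_ltn_trans mi.
have k_act : ~~ inst k by apply: states_at_active mS mk.
have /states_atP[mS0 _] := mS; have [m' mm'] := jump_exists i mS0 mk.
apply: (IHh m'); last 2 first.
- exact: jump_states_at mm'.
- exact: spreads_trans (spreads_center k_act) (center_spreads i_act) _ _ mS rm mm'.
rewrite -ltnS; apply: leq_trans nm_h; rewrite ltnS.
rewrite [leqRHS](bigD1 i) // [X in (X < _)%N](bigD1 i) //.
have /andP[_ /forallP H] := mm'.
have ik : i != k by apply: contraTneq nk => <-; rewrite -leqNgt ltnW.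
rewrite -addSn leq_add //.
  have /eqP := H i; rewrite eqxx (negPf ik) addn0 addn1 => ->.
  by rewrite -subSn // subSS.
apply: leq_sum => l li; have /eqP := H l; rewrite (negPf li) addn0.
have [->|_] := eqVneq l k; rewrite ?addn1 ?addn0 => E; last by rewrite E.
by move: nk; rewrite -E ltnS => nk; rewrite (eqP nk).
Qed.

End ZeroSet.

Definition product_form : {ffun state J N -> R} :=
  [ffun n => if n \in states_at a d N x then weight n / norm_const N.+1 N else 0].

Lemma norm_const_gt0 M k : (k < M)%N -> 0 < norm_const M k.
Proof.
move=> kM; rewrite /norm_const (bigD1 center) //=; apply: coef_gt0M.
- by apply: poly_prod_nneg => l; apply: load_ge0.
- by apply: coef_nneg_prod => i; apply: poly_prod_nneg => l; apply: load_ge0.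
- by rewrite coef_poly kM node_weight_gt0.
apply: coef0_prod_gt0 => i.
by rewrite coef_poly (leq_ltn_trans _ kM) // /node_weight big_ord0.
Qed.

Lemma product_form_stationary : is_stationary a D d s mu x product_form.
Proof.
have G0 := @norm_const_gt0 N.+1 N (ltnSn N).
split=> [n|n /negPf nS||n nS].
- by rewrite ffunE; case: ifP => // _; rewrite divr_ge0 ?weight_ge0 // ltW.
- by rewrite ffunE nS.
- under eq_bigr => n nS do rewrite ffunE nS.
  by rewrite -mulr_suml sum_weight_at divff // gt_eqF.
rewrite ffunE nS outflow // mulrAC -inflow // mulr_suml; apply: eq_bigr => n' n'S.
by rewrite ffunE n'S mulrAC.
Qed.

(** With [c] the least ratio [p n / weight n], the function [p - c * weight] is a nonnegative
    solution of the balance equations with a zero, hence it vanishes on all of [states_at]. Total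
    mass one determines [c]. *)
Lemma is_stationary_unique p : is_stationary a D d s mu x p -> p = product_form.
Proof.
move=> [p_ge0 p_out p_sum p_bal].
have [n0 n0S] : exists n0, n0 \in states_at a d N x.
  apply/existsP; apply: contraPT p_sum => /existsPn nS.
  rewrite big_pred0; first by move/eqP; rewrite eq_sym oner_eq0.
  by move=> n; apply/negbTE.
have [m mS m_min] := @arg_minP _ _ _ n0 (mem (states_at a d N x)) (fun n => p n / weight n) n0S.
pose c := p m / weight m.
have r0 : forall n, n \in states_at a d N x -> p n - c * weight n = 0.
  move=> n nS; apply: (spreads_everywhere (r := fun n => p n - c * weight n) _ _ nS mS).
  - move=> n1 n1S; rewrite subr_ge0 -ler_pdivlMr ?weight_gt0 //; exact: m_min.
  - move=> n1 n1S; rewrite outflow // mulrBl -mulrA -inflow // -(outflow n1S) p_bal //.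
    by rewrite mulr_sumr -sumrB; apply: eq_bigr => n' _; rewrite mulrBl mulrA.
  by rewrite /c divfK ?subrr // gt_eqF ?weight_gt0.
have cE : c = (norm_const N.+1 N)^-1.
  apply: (mulIf (lt0r_neq0 (norm_const_gt0 (ltnSn N)))).
  rewrite mulVf ?lt0r_neq0 ?norm_const_gt0 //.
  rewrite -sum_weight_at mulr_sumr -p_sum; apply: eq_bigr => n nS.
  by apply/esym/eqP; rewrite -subr_eq0 r0.
apply/ffunP => n; rewrite ffunE; case: ifPn => [nS|/p_out //].
by have /eqP := r0 n nS; rewrite subr_eq0 cE mulrC => /eqP.
Qed.

Lemma stationary_distributionE : stationary_distribution a D d s mu N x = product_form.
Proof. by apply: xget_unique; [exact: product_form_stationary|exact: is_stationary_unique]. Qed.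

(** * Throughputs as ratios of normalization constants *)

Lemma norm_constE M k : (k < M)%N -> norm_const M k = norm_const k.+1 k.
Proof.
move=> kM; apply: (coef_eq_lt_prod (M := k.+1)) => // i l lk.
by rewrite !coef_poly lk (leq_trans lk).
Qed.

(** By [node_weight_rec], weighting by the service rate of warehouse [j] multiplies its generating
    function by [rho D j] times ['X], which lowers the population by one. *)
Lemma sum_weight_rate j : (0 < N)%N ->
  \sum_(n in states J N) weight n * rate (warehouse j) (n (warehouse j))
  = rho D j * norm_const N.+1 N.-1.
Proof.
move=> N_gt0.
pose f i (l : nat) := if i == warehouse j then node_weight i l * rate i l else node_weight i l.
transitivity ((\prod_i \poly_(l < N.+1) f i l)`_N).
  rewrite coef_prod_poly; apply: eq_big => [n|n _]; first by rewrite inE.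
  rewrite /weight (bigD1 (warehouse j)) //= [RHS](bigD1 (warehouse j)) //= {1}/f eqxx mulrAC.
  by congr (_ * _); apply: eq_bigr => i /negPf; rewrite /f => ->.
rewrite (bigD1 (warehouse j)) //=.
rewrite (@coef_eq_ltM _ N.+1 _ (rho D j *: ('X * gen_fun N.+1 (warehouse j))) _
  (\prod_(i | i != warehouse j) gen_fun N.+1 i)) //; last 2 first.
- move=> k kN; rewrite coefZ coefXM coef_poly kN /f eqxx; case: k kN => [|k] kN.
    by rewrite service_rate0 !mulr0.
  by rewrite node_weight_rec // coef_poly (ltnW kN).
- move=> k kN; rewrite [in LHS](eq_bigr (gen_fun N.+1)) // => i /negPf ij.
  by apply/polyP => l; rewrite !coef_poly /f ij.
rewrite -scalerAl -mulrA coefZ coefXM (gtn_eqF N_gt0); congr (_ * _).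
by rewrite /norm_const [in RHS](bigD1 (warehouse j)).
Qed.

End Population.

Lemma THE N M j : (0 < N)%N -> (N < M)%N ->
  TH a D d s mu N x j = rho D j * (norm_const M N.-1 / norm_const M N).
Proof.
move=> N_gt0 NM; rewrite (norm_constE NM) (@norm_constE M); last lia.
rewrite -(@norm_constE N.+1 N.-1); last lia.
rewrite mulrA -sum_weight_rate // mulr_suml /TH stationary_distributionE.
apply: eq_bigr => n nS; rewrite ffunE; case: ifPn => [_|nS']; first by rewrite mulrAC.
by rewrite weight_eq0 // !mul0r.
Qed.

Lemma THwE N M : (0 < N)%N -> (N < M)%N ->
  THw a D d s mu N x = norm_const M N.-1 / norm_const M N.
Proof.
move=> N_gt0 NM; rewrite /THw.
under eq_bigr do rewrite (THE _ N_gt0 NM).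
by rewrite -mulr_suml sum_rho mul1r.
Qed.

Lemma TH_THw N j : (0 < N)%N -> TH a D d s mu N x j = rho D j * THw a D d s mu N x.
Proof. by move=> N_gt0; rewrite (THE _ N_gt0 (ltnSn N)) (THwE N_gt0 (ltnSn N)). Qed.

Lemma THw_lt_succ N : (0 < N)%N -> THw a D d s mu N x < THw a D d s mu N.+1 x.
Proof.
case: N => // n _; rewrite (@THwE n.+1 n.+3) // (@THwE n.+2 n.+3) //=.
rewrite ltr_pdivrMr ?norm_const_gt0 // mulrAC ltr_pdivlMr ?norm_const_gt0 //.
(* The two factors for strictness are the center and the rest; the rest has a positive coefficient
   in degree [n.+1] because it contains a warehouse. *)
rewrite /norm_const (bigD1 center) //=.
have gen_nneg i : coef_nneg (gen_fun n.+3 i).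
  by apply: poly_prod_nneg => l; apply: load_ge0.
have gen_lc i : log_concave (gen_fun n.+3 i).
  by apply: poly_prod_log_concave => [l|l m]; [exact: load_ge0|exact: load_le].
have gen0 i : 0 < (gen_fun n.+3 i)`_0 by rewrite coef_poly /node_weight big_ord0.
apply: log_concaveM_strict => //.
- exact: coef_nneg_prod.
- exact: log_concave_prod.
- by rewrite coef_poly leqnSn node_weight_gt0.
- exact: coef0_prod_gt0.
have j : 'I_J.-1 by exists 0%N; lia.
rewrite (bigD1 (warehouse j)) //=; apply: coef_gt0M => //.
- exact: coef_nneg_prod.
- by rewrite coef_poly leqnSn node_weight_gt0.
- exact: coef0_prod_gt0.
Qed.

Lemma THw_inj N N' : (0 < N)%N -> (0 < N')%N ->
  THw a D d s mu N x = THw a D d s mu N' x -> N = N'.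
Proof.
have THw_lt n m : (0 < n)%N -> (n < m)%N -> THw a D d s mu n x < THw a D d s mu m x.
  move=> n_gt0; elim: m => // m IHm; rewrite ltnS leq_eqVlt => /predU1P[<-|nm].
    exact: THw_lt_succ.
  by apply: lt_trans (IHm nm) (THw_lt_succ _); lia.
move=> N_gt0 N'_gt0 E; case: (ltngtP N N') => // [lt|lt].
  by have := THw_lt _ _ N_gt0 lt; rewrite E ltxx.
by have := THw_lt _ _ N'_gt0 lt; rewrite E ltxx.
Qed.

(** * Dependence on the location *)

Definition weber_cost := \sum_j rho D j * dst j.

(** Infinite-server weights are exponential coefficients. For [dst j = 0] only the constant term
    survives on both sides. *)
Lemma gen_fun_outbound M j : gen_fun M (outbound j) = exp_poly M (rho D j * dst j).
Proof.
apply/polyP => n; rewrite !coef_poly; case: ifP => // _.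
elim: n => [|n IHn]; first by rewrite /node_weight big_ord0 expr0 divr1.
rewrite /node_weight big_ord_recr /= -/(node_weight _ n) IHn /load /=.
rewrite invf_div [_ * (dst j / _)]mulrA.
by rewrite mulf_div -exprSr -natrM mulnC -factS.
Qed.

Definition station_gen_fun M : {poly R} := \prod_(k : station J) gen_fun M (inl k).

(* The superposition of the travel nodes is a single infinite server of load  *)
(* [2 * weber_cost]: the location enters the throughputs only through it.     *)
Lemma gen_fun_prod M : coef_eq_lt M (\prod_i gen_fun M i)
  (station_gen_fun M * exp_poly M (weber_cost + weber_cost)).
Proof.
rewrite !big_sumType /=; apply: coef_eq_ltM => // k kM.
(* [gen_fun M (inbound j)] and [gen_fun M (outbound j)] are convertible. *)
rewrite (eq_bigr _ (fun j _ => gen_fun_outbound M j)).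
by rewrite -exp_polyD // (coef_eq_ltM (@exp_poly_sum _ _ _ _) (@exp_poly_sum _ _ _ _)).
Qed.

End Location.

Lemma station_gen_fun_loc x y M : station_gen_fun x M = station_gen_fun y M.
Proof. by []. Qed.

Lemma THw_antitone N x y : (0 < N)%N -> weber_cost x <= weber_cost y ->
  THw a D d s mu N y <= THw a D d s mu N x.
Proof.
case: N => // n _ le_xy; rewrite !(@THwE _ n.+1 n.+2) //=.
rewrite ler_pdivrMr ?norm_const_gt0 // mulrAC ler_pdivlMr ?norm_const_gt0 //.
pose h := weber_cost y - weber_cost x; have h_ge0 : 0 <= h by rewrite subr_ge0.
(* The stations do not see the location, so moving from [x] to [y] only contributes the exponential
   of the cost difference, once for each direction of travel. *)
have E : coef_eq_lt n.+2 (\prod_i gen_fun y n.+2 i)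
    (\prod_i gen_fun x n.+2 i * exp_poly n.+2 (h + h)).
  move=> k kn; rewrite gen_fun_prod //.
  rewrite (coef_eq_ltM (@gen_fun_prod x _) (q' := exp_poly n.+2 (h + h))) //.
  rewrite -mulrA (station_gen_fun_loc x y).
  apply: coef_eq_ltM kn => // l ln; rewrite exp_polyD //; congr ((exp_poly _ _)`_l).
  by rewrite /h; ring.
rewrite /norm_const !E // coef_ratio_le //.
- by apply: coef_nneg_prod => i; apply: poly_prod_nneg => l; apply: load_ge0.
- apply: log_concave_prod => i; first by apply: poly_prod_nneg => l; apply: load_ge0.
  by apply: poly_prod_log_concave => [l|l m]; [exact: load_ge0|exact: load_le].
- move=> l; rewrite coef_poly; case: ifP => // _.
  by rewrite divr_ge0 // exprn_ge0 // addr_ge0.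
Qed.

End Equilibrium.

Theorem theorem4p5 (R : realType) (J : nat) (hJ : (2 <= J)%N)
    (a : 'I_J.-1 -> 'rV[R]_2) (D : 'I_J.-1 -> R)
    (d : 'rV[R]_2 * 'rV[R]_2 -> R)
    (s : station J -> nat) (mu : station J -> R)
    (hD : forall j, 0 < D j)
    (hd0 : forall z, 0 <= d z)
    (hd : convex_function [set: 'rV[R]_2 * 'rV[R]_2]%classic d)
    (hs : forall k, (1 <= s k)%N)
    (hmu : forall k, 0 < mu k)
    (hP : exists (N : nat) (x : 'rV[R]_2), P_solution a D d s mu N x)
    (xstar : 'rV[R]_2) (hx : weber_solution a D d xstar) :
  exists! N : nat, (1 <= N)%N /\ P_solution a D d s mu N xstar.
Proof.
have max_xstar n y : (0 < n)%N -> THw a D d s mu n y <= THw a D d s mu n xstar.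
  by move=> n_gt0; apply: THw_antitone => //; apply: hx.
have [N [x [[N_gt0 N_demand x_max] N_min]]] := hP.
have THw_x : THw a D d s mu N x = THw a D d s mu N xstar.
  by apply/eqP; rewrite eq_le max_xstar ?x_max.
exists N; split.
  split=> //; split=> [|N' x' adm]; last by rewrite -THw_x; apply: N_min.
  split=> // [j|y]; last exact: max_xstar.
  (* Equal totals give equal warehouse throughputs, so the demands met at [x] are met at [xstar]. *)
  by rewrite TH_THw // -THw_x -TH_THw.
move=> N' [N'_gt0 [adm' N'_min]]; apply: (@THw_inj _ _ a D d s mu _ _ _ _ _ xstar) => //.
(* Each of the two solutions is minimal against the other, so their throughputs coincide. *)
apply/eqP; rewrite eq_le -{1}THw_x N_min //=; rewrite -THw_x.
by apply: N'_min (x) _; split.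
Qed.
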